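(* Let $k\ge 1$ and let $\mathcal{M}_1,\dots,\mathcal{M}_k$ be loopless matroids on the same finite ground set $V$. Then $$\chi_\ell\Big(\bigcap_{i=1}^k\mathcal{M}_i\Big)\le (2k-1)\max_{1\le i\le k}\chi(\mathcal{M}_i).$$
   Context: A complex on a finite set $V$ is a non-empty family of subsets of $V$ closed under taking subsets; its members are called faces. A matroid is identified with the complex of its independent sets; loopless means that every singleton $\{v\}$, $v\in V$, is independent. The intersection $\bigcap_i\mathcal{M}_i$ is the complex of sets independent in all $\mathcal{M}_i$. The chromatic number $\chi(\mathcal{C})$ of a complex $\mathcal{C}$ on $V$ is the minimum number of faces of $\mathcal{C}$ whose union is $V$. Given sets (lists) $L_v$ of permissible colors for $v\in V$, a $\mathcal{C}$-respecting list coloring is a function $f:V\to\bigcup_{v}L_v$ with $f(v)\in L_v$ for every $v\in V$ and $f^{-1}(c)\in\mathcal{C}$ for every color $c$. The list chromatic number $\chi_\ell(\mathcal{C})$ is the minimum $p$ such that every system of lists $(L_v)_{v\in V}$ with $|L_v|=p$ for all $v$ has a $\mathcal{C}$-respecting list coloring. *)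

(* Defs.v *)
From mathcomp Require Import all_boot.
From mathcomp Require Import boolp.

Set Implicit Arguments.
Unset Strict Implicit.
Unset Printing Implicit Defensive.

(* The value 0 when P has no solution is a dummy; chromatic_numberP and
   list_chromatic_numberP below show that it plays no role for loopless
   complexes. *)
Definition least (P : nat -> Prop) : nat :=
  if pselect (exists n, `[< P n >]) is left exP then ex_minn exP else 0.

Lemma leastP (P : nat -> Prop) :
  (exists n, P n) -> P (least P) /\ forall m, P m -> least P <= m.
Proof.
move=> [n Pn]; rewrite /least; case: pselect => [exP|[]]; last first.
  by exists n; apply/asboolP.
by case: ex_minnP => m /asboolP Pm min_m; split=> // j /asboolP/min_m.
Qed.

Section Complexes.
Variable V : finType.
Implicit Types (C M : {set {set V}}) (A B : {set V}).

Definition is_complex C : Prop :=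
  C != set0 /\ forall A B, A \subset B -> B \in C -> A \in C.

Definition is_matroid M : Prop :=
  is_complex M /\
  forall A B, A \in M -> B \in M -> #|A| < #|B| ->
    exists2 x, x \in B :\: A & x |: A \in M.

Definition loopless C : Prop := forall v : V, [set v] \in C.

Definition covered_by_faces C (n : nat) : Prop :=
  exists S : {set {set V}}, [/\ S \subset C, cover S = [set: V] & #|S| = n].

Definition chromatic_number C : nat := least (covered_by_faces C).

Definition respecting_list_coloring C (K : finType) (L : V -> {set K})
    (f : V -> K) : Prop :=
  (forall v, f v \in L v) /\ (forall c, f @^-1: [set c] \in C).

(* A system of p-element lists on the finite set V uses finitely many colors,
   so letting K range over all finite types covers every system of lists. *)
Definition list_colorable C (p : nat) : Prop :=
  forall (K : finType) (L : V -> {set K}), (forall v, #|L v| = p) ->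
    exists f : V -> K, respecting_list_coloring C L f.

Definition list_chromatic_number C : nat := least (list_colorable C).

Lemma chromatic_numberP C : loopless C ->
  covered_by_faces C (chromatic_number C) /\
  forall n, covered_by_faces C n -> chromatic_number C <= n.
Proof.
move=> loopC; apply: leastP.
exists #|[set [set v] | v : V]|, [set [set v] | v : V]; split=> //.
  by apply/subsetP=> _ /imsetP[v _ ->].
apply/setP=> v; rewrite inE; apply/bigcupP.
by exists [set v]; rewrite ?set11 ?imset_f.
Qed.

(* With lists of size #|V|, a greedy choice gives an injective coloring. *)
Lemma list_chromatic_numberP C : is_complex C -> loopless C ->
  list_colorable C (list_chromatic_number C) /\
  forall p, list_colorable C p -> list_chromatic_number C <= p.
Proof.
move=> [C0 Cdown] loopC; apply: leastP; exists #|V| => K L cardL.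
have someI : injective (@Some K) by move=> x y [].
have greedy (s : seq V) : uniq s ->
    exists f : V -> option K,
      {in s, forall v, exists2 c, f v = Some c & c \in L v} /\
      {in s &, injective f}.
  elim: s => [_|v s IHs /= /andP[vs us]]; first by exists (fun=> None).
  have [f [fL finj]] := IHs us.
  have /subsetPn[c cL cf] : ~~ (L v \subset [set c | Some c \in map f s]).
    apply/negP=> /subset_leq_card; rewrite cardL leqNgt => /negP; apply.
    apply: (@leq_ltn_trans (size s)).
      rewrite -(card_imset _ someI) -(size_map f s).
      apply: leq_trans (card_size _); apply: subset_leq_card.
      by apply/subsetP=> y /imsetP[c]; rewrite inE => cf ->.
    have /card_uniqP : uniq (v :: s) by rewrite /= vs us.
    by move=> /= e; rewrite -[_ < _]/(_.+1 <= _) -e; exact: max_card.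
  rewrite inE in cf.
  exists (fun u => if u == v then Some c else f u); split.
    by move=> u; rewrite inE; case: eqP => [-> _|_ /= /fL//]; exists c.
  move=> u w; rewrite !inE.
  case: eqP => [->|_]; case: eqP => [->|_] //=.
  - by move=> _ ws e; rewrite e map_f in cf.
  - by move=> us' _ e; rewrite -e map_f in cf.
  - exact: finj.
have [f [fL finj]] := greedy _ (enum_uniq V).
have fS v : {c | f v = Some c /\ c \in L v}.
  by case E: (f v) => [c|]; [exists c | exfalso];
    have [d] := fL v (mem_enum _ v); rewrite E // => -[->].
exists (fun v => sval (fS v)); split=> [v|c]; first by case: (svalP (fS v)).
have [v fv|nov] := pickP (fun v => sval (fS v) == c).
  apply: Cdown (loopC v); apply/subsetP=> u; rewrite !inE => /eqP fu.
  apply/eqP/finj; rewrite ?mem_enum //.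
  by rewrite (svalP (fS u)).1 (svalP (fS v)).1 fu (eqP fv).
have [A AC] := set0Pn _ C0.
by apply: Cdown AC; apply/subsetP=> u; rewrite !inE nov.
Qed.

End Complexes.

(* Main.v *)
Require Import Defs.
From mathcomp Require Import all_boot zify.

Set Implicit Arguments.
Unset Strict Implicit.
Unset Printing Implicit Defensive.

(** Let D be the largest of the chromatic numbers and let every list have
    (2k-1)D colors.  On the set E of pairs (v, c) with c in L_v, put k matroid
    structures: the i-th one declares a set of pairs independent when each of
    its color slices is independent in M_i.  A list coloring is the same thing
    as a common independent set of these k matroids that meets the fiber over
    each vertex v exactly once.

    Such transversals are found topologically.  Call a complex acyclic up to g
    when every mod 2 cycle formed of faces with fewer than g elements is a
    boundary (reduced homology, the empty face included).  A Sperner type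
    parity argument ([exists_transversal_face]) shows that a complex on E has a
    transversal face as soon as, for each set J of vertices, its restriction to
    the pairs over J is acyclic up to |J|.

    It remains to bound from below the acyclicity of the common independent
    sets of k matroids with rank functions r_1, ..., r_k on a set S
    ([acyclic_common_independent]): it is at least g whenever every covering of
    S by sets X_1, ..., X_k satisfies r_1(X_1) + ... + r_k(X_k) >= (2k-1)g.
    For the pairs over J this holds with g = |J|: a set covered by D
    independent sets has at most D times its rank elements, so the sum of the
    ranks is at least |E_J| / D = (2k-1)|J|.

    The bound is proved by freeing the matroids step by step.  After deletion
    of the loops of each matroid, replace some r_i by its elongation min(r_i + 1, |.|).
    Each new face A contains exactly one circuit sigma of the old r_i, and the
    new faces with circuit sigma form the star of sigma, whose link is the
    complex of common independent sets of the contractions by sigma.  Removing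
    the stars again costs nothing in acyclicity up to g provided that these
    links are acyclic up to g - (|sigma| - 1) ([acyclic_delete_stars]).  The
    contraction lowers the sum of ranks of a covering by at most |sigma| - 1 in
    the i-th matroid, where sigma is a circuit, and by |sigma| in each of the
    others; since sigma is not a loop, k|sigma| - 1 <= (2k-1)(|sigma| - 1), and
    induction applies.  The process ends with free matroids on a non-empty set,
    that is with a full simplex, which is acyclic in all degrees, or with S
    empty, where the covering condition forces g = 0. *)

(** * Parity sums and sets *)

(** Off the diagonal the summands come in equal pairs, which cancel modulo 2.
    This one fact is behind both the identity boundary o boundary = 0 and the
    cycle condition in the construction of [exists_transversal_face]. *)
Lemma addb_sum_sym (T : finType) (P : pred T) (f : T -> T -> bool) :
    (forall a b, f a b = f b a) -> (forall a, f a a = false) ->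
  \big[addb/false]_(a | P a) \big[addb/false]_(b | P b) f a b = false.
Proof.
move=> fC f0.
pose lt (a b : T) := enum_rank a < enum_rank b.
have split a b : f a b = (lt a b && f a b) (+) (lt b a && f b a).
  rewrite [f b a]fC /lt.
  case: (ltngtP (enum_rank a) (enum_rank b)) => [||/ord_inj/enum_rank_inj->];
    by rewrite /= ?addbF ?f0.
under eq_bigr do (under eq_bigr do rewrite split; rewrite big_split).
by rewrite big_split /= [X in _ (+) X]exchange_big /= addbb.
Qed.

Lemma addb_sum_exists (T : finType) (P : pred T) (f : T -> bool) :
  \big[addb/false]_(x | P x) f x -> exists2 x, P x & f x.
Proof.
move=> h; apply/exists_inP; apply: contraLR h; rewrite negb_exists_in.
by move/forall_inP=> h; rewrite big1 // => x /h/negbTE.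
Qed.

Lemma disjoint_setU1 (T : finType) x (A B : {set T}) :
  [disjoint x |: A & B] = (x \notin B) && [disjoint A & B].
Proof. by rewrite !disjoints_subset subUset sub1set inE. Qed.

Lemma setD_subK (T : finType) (A B : {set T}) : B \subset A -> (A :\: B) :|: B = A.
Proof. by move/setIidPr=> e; rewrite -[X in _ :|: X]e setUC setID. Qed.

(** * Chains modulo 2 *)

Section Chains.
Variable T : finType.
Implicit Types (A B S sigma : {set T}) (C : {set {set T}}) (c y z : {set T} -> bool).

Definition boundary c A := \big[addb/false]_(x | x \notin A) c (x |: A).

Lemma boundaryD c c' A :
  boundary (fun B => c B (+) c' B) A = boundary c A (+) boundary c' A.
Proof. exact: big_split. Qed.

Lemma boundaryK c A : boundary (boundary c) A = false.
Proof.
pose f a b := (a != b) && c (a |: (b |: A)).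
rewrite -[RHS](@addb_sum_sym _ (fun x => x \notin A) f); first last.
- by move=> a; rewrite /f eqxx.
- by move=> a b; rewrite /f eq_sym setUCA.
apply: eq_bigr => a _; rewrite [RHS](bigID (fun b => b == a)) /=.
rewrite [X in X (+) _]big1 ?addFb => [|b /andP[_ /eqP->]]; last by rewrite /f eqxx.
apply: eq_big => [b|b ba]; first by rewrite !inE negb_or andbC.
by rewrite /f eq_sym; move: ba; rewrite !inE negb_or => /andP[-> _]; rewrite setUCA.
Qed.

(** The parameter d is the number of elements of the faces, so that the empty
    face is the only one of a chain with d = 0 and homology is reduced. *)
Definition chain_on C d c := forall A, c A -> A \in C /\ #|A| = d.

(** This is the homological connectivity parameter, usually written eta(C) >= g,
    with coefficients modulo 2.  It holds for every g when C has no face at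
    all. *)
Definition acyclic C g := forall d z, d < g -> chain_on C d z ->
  (forall A, boundary z A = false) ->
  exists2 y, chain_on C d.+1 y & forall A, boundary y A = z A.

Definition complex C := forall A B, A \subset B -> B \in C -> A \in C.

Definition link C sigma := [set A : {set T} | [disjoint A & sigma] && (A :|: sigma \in C)].

(** Coning with a vertex of S fills every cycle. *)
Lemma acyclic_powerset S g : S != set0 -> acyclic (powerset S) g.
Proof.
case/set0Pn=> v vS d z _ zS z0.
exists (fun A => (v \in A) && z (A :\ v)) => [A /andP[vA /zS[]]|A].
  rewrite !powersetE => sub card; split; last by rewrite (cardsD1 v) vA card.
  by rewrite -(setD1K vA) subUset sub1set vS.
have [vA|vA] := boolP (v \in A); last first.
  rewrite /boundary (bigD1 v) //= big1 ?addbF => [|x /andP[_ xv]].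
    by rewrite setU11 setU1K.
  by rewrite !inE (negPf vA) eq_sym (negPf xv).
have := z0 (A :\ v); rewrite /boundary (bigD1 v) ?setD11 //= setD1K //.
move/(congr1 (addb (z A))); rewrite addKb addbF => <-.
apply: eq_big => [x|x xA].
  rewrite !inE negb_and negbK.
  by case: eqP => [->|_] /=; rewrite ?vA ?andbT ?andbF.
rewrite !inE vA orbT /=; congr z; apply/setP=> w; rewrite !inE.
by case: eqP => [->|//]; case: eqP => [e|] //=; rewrite -e vA in xA.
Qed.

(** Fill the cycle z in C by y.  The part of y in the star of sigma is sigma * u
    for a chain u of the link, and u is a cycle because z avoids the star.
    Filling u by w in the link, the boundary of sigma * w agrees with y on the
    star of sigma, so adding it moves y off the star without changing its
    boundary. *)
Lemma acyclic_delete_star C sigma g : complex C ->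
    acyclic C g -> acyclic (link C sigma) (g.+1 - #|sigma|) ->
  acyclic [set A in C | ~~ (sigma \subset A)] g.
Proof.
move=> Cdown acC acL d z dg zC z0.
have [A zA|y yC yz] := acC d z dg _ z0.
  by have [] := zC A zA; rewrite inE => /andP[].
pose u A := [disjoint A & sigma] && y (A :|: sigma).
have bu A : boundary u A = false.
  have [dA|dA] := boolP [disjoint A & sigma]; last first.
    rewrite /boundary big1 // => x _; rewrite /u disjoint_setU1.
    by rewrite (negPf dA) andbF.
  have : boundary y (A :|: sigma) = false.
    apply/negbTE/negP; rewrite yz => /zC[].
    by rewrite inE subsetUr andbF.
  move=> <-; rewrite /boundary /u.
  rewrite [LHS](bigID (fun x => x \in sigma)) /= big1 ?addFb => [|x /andP[_ xs]].
    apply: eq_big => [x|x /andP[_ xs]]; first by rewrite inE negb_or.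
    by rewrite disjoint_setU1 dA xs setUA.
  by rewrite disjoint_setU1 xs.
(* When sigma has more elements than the faces of y, the chain u vanishes and
   the truncated subtraction in the degree of the link is meaningless. *)
have [w wL wu] : exists2 w : {set T} -> bool,
    forall A, w A -> A \in link C sigma /\ #|A| + #|sigma| = d.+2 &
    forall A, boundary w A = u A.
  have [le_sd|lt_ds] := leqP #|sigma| d.+1; last first.
    exists (fun=> false) => // A; rewrite /boundary big1 //.
    apply/esym/negbTE/negP=> /andP[_ /yC[_ card]].
    have := subset_leq_card (subsetUr A sigma); lia.
  have [|A|//|w wL wu] := acL (d.+1 - #|sigma|) u; first by lia.
    move=> /andP[dA yA]; have [CA card] := yC _ yA; split; first by rewrite inE dA.
    by move: card; rewrite cardsU disjoint_setI0 // cards0; lia.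
  by exists w => // A /wL[linkA card]; split=> //; lia.
pose q A := (sigma \subset A) && w (A :\: sigma).
have qC A : q A -> A \in C /\ #|A| = d.+2.
  case/andP=> sA /wL[]; rewrite inE setD_subK // => /andP[_ CA] card.
  split=> //; have := cardsID sigma A; rewrite (setIidPr sA); lia.
exists (fun A => y A (+) boundary q A) => [A|A]; last first.
  by rewrite boundaryD boundaryK addbF.
have [sA|sA] := boolP (sigma \subset A).
  suff -> : boundary q A = y A by rewrite addbb.
  transitivity (u (A :\: sigma)); last first.
    by rewrite /u setD_subK // -setI_eq0 setIDAC setDIl setDv setI0 eqxx.
  rewrite -wu /boundary [RHS](bigID (fun x => x \in sigma)) /=.
  rewrite [X in X (+) _]big1 ?addFb => [|x /andP[_ xs]]; last first.
    by apply/negbTE/negP=> /wL[]; rewrite inE disjoint_setU1 xs.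
  apply: eq_big => [x|x xA].
    by rewrite !inE; case: (boolP (x \in sigma)) => [/(subsetP sA)->|]; rewrite ?andbT ?andbF.
  rewrite /q (subset_trans sA (subsetUr _ _)) setDUl; congr (w (_ :|: _)).
  by apply/setDidPl; rewrite disjoints1; apply: contra xA => /(subsetP sA).
move=> /addbP yqA; rewrite inE sA andbT.
have [yA|] := boolP (y A); first exact: yC.
rewrite yqA => bq.
have [x xA qx] : exists2 x, x \notin A & q (x |: A).
  exact: addb_sum_exists.
have [CA card] := qC _ qx; split; first exact: Cdown (subsetUr _ _) CA.
by move: card; rewrite cardsU1 xA => -[].
Qed.

Definition delete_stars C (s : seq {set T}) :=
  [set A in C | all (fun sigma : {set T} => ~~ (sigma \subset A)) s].

(** The stars are disjoint when no face contains two members of s, so deleting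
    one of them does not change the links of the others. *)
Lemma acyclic_delete_stars C (s : seq {set T}) g : complex C ->
    {in s &, forall (sigma rho : {set T}) A, A \in C ->
      sigma \subset A -> rho \subset A -> sigma = rho} ->
    acyclic C g ->
    {in s, forall sigma : {set T}, acyclic (link C sigma) (g.+1 - #|sigma|)} ->
  acyclic (delete_stars C s) g.
Proof.
move=> Cdown; elim: s => [_ acC _|sigma s IHs uniqC acC acL].
  suff -> : delete_stars C [::] = C by [].
  by apply/setP=> A; rewrite inE andbT.
have {IHs}acCs : acyclic (delete_stars C s) g.
  apply: IHs => // [r1 r2 i1 i2|r i]; last by apply: acL; rewrite inE i orbT.
  by apply: uniqC; rewrite inE (i1, i2) orbT.
have [ins|nins] := boolP (sigma \in s).
  suff -> : delete_stars C (sigma :: s) = delete_stars C s by [].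
  apply/setP=> A; rewrite !inE /=; case: allP => [/(_ _ ins) -> //|_].
  by rewrite andbF.
have -> : delete_stars C (sigma :: s) =
    [set A in delete_stars C s | ~~ (sigma \subset A)].
  by apply/setP=> A; rewrite !inE /= -andbA [X in _ && X]andbC.
apply: acyclic_delete_star => //.
  move=> A B AB; rewrite !inE => /andP[/(Cdown _ _ AB)-> /allP sB].
  by apply/allP=> r /sB; apply: contra => /subset_trans; apply.
suff -> : link (delete_stars C s) sigma = link C sigma by apply: acL; rewrite mem_head.
apply/setP=> A; rewrite !inE; case: (boolP (A :|: sigma \in C)) => //= CA.
congr (_ && _); apply/allP=> r rs; apply/negP=> rA.
have e : r = sigma by apply: (uniqC _ _ _ _ _ CA) => //; rewrite ?inE ?rs ?eqxx ?orbT ?subsetUr.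
by rewrite -e rs in nins.
Qed.

(** * Transversal faces *)

Section TransversalFace.
Variables (V : finType) (p : T -> V).
Implicit Types (I J : {set V}).

Definition restrict C J := [set A in C | p @: A \subset J].

(** The parity of the number of faces of c that p maps bijectively onto J, that
    is the coefficient of the simplex J in the push-forward of c along p. *)
Definition degree c J :=
  \big[addb/false]_(A : {set T} | (p @: A == J) && (#|A| == #|J|)) c A.

(** Sperner's parity count: a face that p maps bijectively onto J has exactly
    one facet lying bijectively over J minus i, and any other face over J has
    none or two of them. *)
Lemma degree_boundary c J i : i \in J ->
    (forall A, c A -> p @: A \subset J /\ #|A| = #|J|) ->
  degree (boundary c) (J :\ i) = degree c J.
Proof.
move=> iJ cJ; have cardJ := cardsD1 i J; rewrite iJ in cardJ.
pose P x A := (x \in A) && ((p @: (A :\ x) == J :\ i) && (#|A :\ x| == #|J :\ i|)).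
transitivity (\big[addb/false]_A \big[addb/false]_(x | P x A) c A).
  rewrite /degree /boundary (exchange_big_dep predT) //= [RHS](exchange_big_dep predT) //=.
  apply: eq_bigr => x _.
  rewrite (reindex_onto (fun A => A :\ x) (fun A => x |: A)) /=; last first.
    by move=> A /andP[_ xA]; rewrite setU1K.
  have e A : (x |: A :\ x == A) = (x \in A).
    by apply/eqP/idP=> [<-|/setD1K//]; rewrite setU11.
  apply: eq_big => [A|A /andP[_]].
    by rewrite e setD11 andbT /P andbC.
  by rewrite e => /setD1K->.
rewrite /degree [RHS]big_mkcond /=; apply: eq_bigr => A _.
case cA: (c A); last by rewrite big1 // if_same.
have [AJ cardA] := cJ A cA.
have PE x : P x A = (x \in A) && (p @: (A :\ x) == J :\ i).
  rewrite /P; case: (boolP (x \in A)) => //= xA.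
  have -> : #|A :\ x| = #|J :\ i| by have := cardsD1 x A; rewrite xA; lia.
  by rewrite eqxx andbT.
have inj x : P x A -> {in A :\ x &, injective p}.
  by case/and3P=> xA /eqP e card; apply/imset_injP; rewrite e eq_sym.
rewrite cardA eqxx andbT; case: eqP => [eJ|neJ].
  have pinj : {in A &, injective p} by apply/imset_injP; rewrite eJ cardA.
  have [x0 x0A px0] : exists2 x0, x0 \in A & i = p x0 by apply/imsetP; rewrite eJ.
  rewrite (big_pred1 x0) // => x; rewrite PE /=.
  apply/andP/eqP=> [[xA /eqP eD]|->].
    apply/eqP/contraT=> xx0; have : i \in J :\ i.
      by rewrite -eD px0 imset_f // !inE eq_sym xx0.
    by rewrite setD11.
  split=> //; rewrite eqEcard; apply/andP; split.
    apply/subsetP=> _ /imsetP[y /setD1P[yx yA] ->]; rewrite !inE px0 -eJ imset_f // andbT.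
    by apply: contra yx => /eqP/pinj->.
  rewrite card_in_imset; last by apply: sub_in2 pinj => y /setD1P[].
  by move: (cardsD1 x0 A); rewrite x0A cardA cardJ; lia.
(* The face has size |J| but covers only J minus i, hence exactly one pair a, b
   of its elements collides, and these two are the ones that can be dropped. *)
have [a Pa|P0] := pickP (fun x => P x A); last by rewrite big_pred0.
have := Pa; rewrite PE => /andP[aA /eqP ea].
have pai : p a != i.
  apply/eqP=> e; apply: neJ; rewrite -(setD1K aA) imsetU1 ea e setD1K //.
have /imsetP[b bD eab] : p a \in p @: (A :\ a).
  by rewrite ea !inE pai (subsetP AJ) ?imset_f.
have /setD1P[ba bA] := bD.
have Pb : P b A.
  rewrite PE bA -ea.
  have -> : A :\ b = a |: (A :\ a) :\ b.
    have -> : (A :\ a) :\ b = (A :\ b) :\ a by rewrite !setDDl setUC.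
    by rewrite setD1K // !inE eq_sym ba aA.
  by rewrite imsetU1 eab -imsetU1 setD1K ?eqxx.
rewrite (bigD1 a) //= (big_pred1 b) // => x /=.
have [->|xb] := eqVneq x b; first by rewrite Pb ba.
have [->|xa] := eqVneq x a; first by rewrite andbF.
rewrite andbT; apply/negP=> /inj /(_ _ _ _ _ eab) e; move/eqP: ba; apply; symmetry; apply: e.
  by rewrite !inE eq_sym xa.
by rewrite !inE eq_sym xb.
Qed.

(** Acyclicity allows to lift the simplex on V to chains: by induction on |J|
    there is a chain x_J over J whose boundary is the sum of the x_(J minus i),
    because that sum is a cycle.  All these chains have odd degree, starting
    from the empty face, so x_V contains a transversal face. *)
Lemma exists_transversal_face C : complex C -> set0 \in C ->
    (forall J, acyclic (restrict C J) #|J|) ->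
  exists A, [/\ A \in C, p @: A = [set: V] & #|A| = #|V|].
Proof.
move=> Cdown C0 acC.
pose good (x : {set V} -> {set T} -> bool) J :=
  [/\ chain_on (restrict C J) #|J| (x J),
      forall A, boundary (x J) A =
        \big[addb/false]_(i in J) x (J :\ i) A & degree (x J) J].
have [x xP] : exists x, forall J, good x J.
  suff /(_ #|V|)[x xP] : forall n, exists x, forall J, #|J| <= n -> good x J.
    by exists x => J; apply/xP/max_card.
  elim=> [|n [x xP]].
    exists (fun _ A => A == set0) => J; rewrite leqn0 cards_eq0 => /eqP->.
    split=> [A /eqP->|A|]; rewrite ?cards0.
    - by rewrite inE C0 imset0 sub0set.
    - rewrite big_set0 /boundary big1 // => a _; apply/negbTE/set0Pn.
      by exists a; rewrite setU11.
    rewrite /degree (big_pred1 set0) ?eqxx // => A /=.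
    by rewrite cards0 cards_eq0; case: (eqVneq A set0) => [->|_]; rewrite ?imset0 ?eqxx ?andbF.
  pose z J A := \big[addb/false]_(i in J) x (J :\ i) A.
  have cardJ J i : #|J| = n.+1 -> i \in J -> #|J :\ i| = n.
    by move=> cJ iJ; have := cardsD1 i J; rewrite iJ; lia.
  have step J : exists y, #|J| = n.+1 ->
      chain_on (restrict C J) n.+1 y /\ forall A, boundary y A = z J A.
    have [cJ|nJ] := eqVneq #|J| n.+1; last first.
      by exists (fun=> false) => cJ; rewrite cJ eqxx in nJ.
    have [||A|y yC yz] := acC J n (z J); rewrite ?cJ //.
    - move=> A /addb_sum_exists[i iJ xA].
      have [/(_ A xA)[]] := xP (J :\ i) (eq_leq (cardJ _ _ cJ iJ)).
      rewrite (cardJ _ _ cJ iJ) !inE => /andP[-> /subset_trans-> //].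
      exact: subD1set.
    - pose f i j := (i != j) && x (J :\ i :\ j) A.
      rewrite -[RHS](@addb_sum_sym _ [in J] f); first last.
      + by move=> a; rewrite /f eqxx.
      + by move=> a b; rewrite /f eq_sym !setDDl [X in _ :\: X]setUC.
      rewrite /boundary exchange_big; apply: eq_bigr => i iJ /=.
      have [_ e _] := xP (J :\ i) (eq_leq (cardJ _ _ cJ iJ)).
      rewrite -[LHS]/(boundary (x (J :\ i)) A) e /f.
      rewrite [RHS](bigID (fun j => j == i)) /=.
      rewrite [X in X (+) _]big1 ?addFb => [|j /andP[_ /eqP->]]; last by rewrite eqxx.
      apply: eq_big => [j|j]; first by rewrite !inE andbC.
      by rewrite !inE eq_sym => /andP[->].
    by exists y.
  have [y yP] := fin_all_exists step.
  pose x' J := if #|J| <= n then x J else y J.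
  have x'D J i : i \in J -> #|J| <= n.+1 -> x' (J :\ i) = x (J :\ i).
    by move=> iJ cJ; rewrite /x' ifT //; have := cardsD1 i J; rewrite iJ; lia.
  exists x' => J leJ; rewrite /good.
  have e A : \big[addb/false]_(i in J) x' (J :\ i) A = z J A.
    by apply: eq_bigr => i iJ; rewrite x'D.
  rewrite /x'; case: leqP => [le_n|lt_n].
    by have [xC bx dx] := xP J le_n; split=> // A; rewrite e bx.
  have cJ : #|J| = n.+1 by lia.
  have [yC yz] := yP J cJ; rewrite cJ; split=> // [A|]; first by rewrite e yz.
  have [i iJ] : exists i, i \in J by apply/set0Pn; rewrite -card_gt0 cJ.
  rewrite -(degree_boundary iJ) => [|A /yC[]]; last first.
    by rewrite inE cJ => /andP[_].
  have [_ _ dx] := xP (J :\ i) (eq_leq (cardJ _ _ cJ iJ)).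
  suff -> : degree (boundary (y J)) (J :\ i) = degree (x (J :\ i)) (J :\ i) by [].
  apply: eq_bigr => A /andP[/eqP pA _]; rewrite yz /z (bigD1 i) //= big1 ?addbF // => j.
  case/andP=> jJ ji; apply/negbTE/negP.
  have [xC _ _] := xP (J :\ j) (eq_leq (cardJ _ _ cJ jJ)).
  move=> /xC[]; rewrite inE pA => /andP[_ /subsetP/(_ j)].
  by rewrite !inE eqxx jJ ji => /(_ isT).
have [xC _ dx] := xP [set: V].
have [A /andP[/eqP pA /eqP cA] xA] := addb_sum_exists dx.
have [] := xC A xA; rewrite inE => /andP[CA _] _.
by exists A; rewrite CA pA cA cardsT.
Qed.

End TransversalFace.
End Chains.

(** * Rank functions of matroids *)

Section RankFunctions.
Variable T : finType.
Implicit Types (A B S sigma rho : {set T}) (r : {set T} -> nat).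

Definition rank_function r := [/\ forall A, r A <= #|A|,
  forall A B, A \subset B -> r A <= r B &
  forall A B, r (A :|: B) + r (A :&: B) <= r A + r B].

Lemma rank_subadditive r A B : rank_function r -> r (A :|: B) <= r A + r B.
Proof. by case=> _ _ /(_ A B); lia. Qed.

(** The nullity |A| - r A is monotone. *)
Lemma rank_nullity r A B : rank_function r -> A \subset B ->
  r B + #|A| <= r A + #|B|.
Proof.
move=> rP sAB; have [r_card _ _] := rP.
have := rank_subadditive A (B :\: A) rP; have := r_card (B :\: A).
have := cardsID A B; rewrite (setIidPr sAB) setUC setD_subK //; lia.
Qed.

(** The matroid whose independent sets become independent after removal of at
    most one element. *)
Definition elongation r A := minn (r A).+1 #|A|.

Lemma rank_function_elongation r : rank_function r -> rank_function (elongation r).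
Proof.
move=> rP; have [r_card r_mono r_sub] := rP; rewrite /elongation; split=> [A|A B sAB|A B].
- exact: geq_minr.
- by have := r_mono _ _ sAB; have := subset_leq_card sAB; lia.
have := r_sub A B; have := r_card A; have := r_card B.
have := rank_nullity rP (subsetUl A B); have := rank_nullity rP (subsetUr A B).
by have := cardsUI A B; lia.
Qed.

Definition contract r sigma A := r (A :|: sigma) - r sigma.

Lemma rank_function_contract r sigma : rank_function r -> rank_function (contract r sigma).
Proof.
move=> rP; have [r_card r_mono r_sub] := rP; rewrite /contract; split=> [A|A B sAB|A B].
- by have := rank_subadditive A sigma rP; have := r_card A; lia.
- by apply/leq_sub2r/r_mono/setSU.
have := r_sub (A :|: sigma) (B :|: sigma); rewrite -setUUl -setUIl.
have := r_mono _ _ (subsetUr (A :&: B) sigma); have := r_mono _ _ (subsetUr (A :|: B) sigma).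
have := r_mono _ _ (subsetUr A sigma); have := r_mono _ _ (subsetUr B sigma).
lia.
Qed.

Definition circuit r sigma := minset (fun A => r A < #|A|) sigma.

Lemma proper_circuit r sigma A : rank_function r -> circuit r sigma ->
  A \proper sigma -> r A = #|A|.
Proof.
case=> r_card _ _ /minsetP[_ min_s] /properP[sAs [x xs xA]].
apply/eqP; rewrite eqn_leq r_card leqNgt; apply/negP=> dep.
by rewrite (min_s A dep sAs) xs in xA.
Qed.

Lemma card_circuit r sigma : rank_function r -> circuit r sigma ->
  #|sigma| = (r sigma).+1.
Proof.
move=> rP cs; have [_ r_mono _] := rP; have [dep _] := minsetP cs.
have [x xs] : exists x, x \in sigma by apply/set0Pn; rewrite -card_gt0; lia.
have := r_mono _ _ (subD1set sigma x).
rewrite (proper_circuit rP cs) ?properD1 //.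
by have := cardsD1 x sigma; rewrite xs; lia.
Qed.

(** A set of nullity at most one contains at most one circuit: the union of two
    distinct circuits has nullity at least two, by submodularity. *)
Lemma circuit_unique r sigma rho A : rank_function r ->
    circuit r sigma -> circuit r rho -> sigma \subset A -> rho \subset A ->
  #|A| <= (r A).+1 -> sigma = rho.
Proof.
move=> rP cs cr sA rA nA; apply/eqP/contraT=> neq.
have [_ min_r] := minsetP cr.
have prop : sigma :&: rho \proper sigma.
  rewrite properE subsetIl subsetI subxx /=; apply/negP=> sr.
  by case/negP: neq; rewrite (min_r sigma) //; case/minsetP: cs.
have := rank_nullity rP (_ : sigma :|: rho \subset A); rewrite subUset sA rA => /(_ isT).
have [_ _ /(_ sigma rho)] := rP; rewrite (proper_circuit rP cs prop).
have := card_circuit rP cs; have := card_circuit rP cr; have := cardsUI sigma rho; lia.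
Qed.

(** * Acyclicity of matroid intersections *)

Definition common_independent k (r : 'I_k -> {set T} -> nat) S :=
  [set A : {set T} | (A \subset S) && [forall i, r i A == #|A|]].

Lemma common_independent_complex k (r : 'I_k -> {set T} -> nat) S :
  (forall i, rank_function (r i)) -> complex (common_independent r S).
Proof.
move=> rP A B sAB; rewrite !inE => /andP[/(subset_trans sAB)-> /forallP indB].
apply/forallP=> i; have := rank_nullity (rP i) sAB; rewrite (eqP (indB i)).
by have [/(_ A) ? _ _] := rP i; lia.
Qed.

Lemma link_common_independent k (r : 'I_k -> {set T} -> nat) S sigma :
    (forall i, rank_function (r i)) -> sigma \in common_independent r S ->
  link (common_independent r S) sigma =
  common_independent (fun i => contract (r i) sigma) (S :\: sigma).
Proof.
move=> rP; rewrite inE => /andP[sS /forallP inds]; apply/setP=> A.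
rewrite !inE subUset sS andbT subsetD [_ && [disjoint _ & _]]andbC -andbA.
case: (boolP [disjoint A & sigma]) => //= dis; congr (_ && _).
apply: eq_forallb => i; rewrite /contract (eqP (inds i)) cardsU (disjoint_setI0 dis) cards0.
by apply/eqP/eqP; have [_ /(_ _ _ (subsetUr A sigma)) + _] := rP i; rewrite (eqP (inds i)); lia.
Qed.

(** Induction on |S| plus the total nullity of S, which decreases when a loop is
    deleted, when a matroid is elongated and when a circuit is contracted.
    If no matroid is left to elongate and S is empty, the hypothesis on
    coverings forces g = 0. *)
Lemma acyclic_common_independent k (r : 'I_k -> {set T} -> nat) S g : 0 < k ->
    (forall i, rank_function (r i)) ->
    (forall X : 'I_k -> {set T}, S \subset \bigcup_i X i ->
      (2 * k - 1) * g <= \sum_i r i (X i)) ->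
  acyclic (common_independent r S) g.
Proof.
move=> k_gt0; have [m] := ubnP (#|S| + \sum_i (#|S| - r i S)).
elim: m => [//|m IHm] in r S g *; rewrite ltnS => le_m rP cov.
(* A loop of one matroid lies in no common independent set, and it can be added
   for free to the part of a covering that belongs to this matroid. *)
have [/exists_inP[x xS /existsP[i /eqP loop]]|] :=
    boolP [exists x in S, [exists i, r i [set x] == 0]].
  have -> : common_independent r S = common_independent r (S :\ x).
    apply/setP=> A; rewrite !inE subsetD1.
    case: (boolP (x \in A)) => [xA|_]; last by rewrite andbT.
    rewrite andbF; apply/negbTE/negP=> /andP[_ /forallP/(_ i)/eqP indA].
    have := rank_nullity (rP i) (_ : [set x] \subset A).
    by rewrite sub1set xA cards1 loop => /(_ isT); lia.
  apply: IHm => // [|X SX].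
    have := cardsD1 x S; rewrite xS => cardS.
    suff : \sum_i (#|S :\ x| - r i (S :\ x)) <= \sum_i (#|S| - r i S) by lia.
    apply: leq_sum => j _; have := rank_nullity (rP j) (subD1set S x).
    by have [/(_ S) ? _ _] := rP j; lia.
  apply: leq_trans (cov (fun j => if j == i then x |: X j else X j) _) _.
    rewrite -(setD1K xS) subUset sub1set; apply/andP; split.
      by apply/bigcupP; exists i; rewrite ?eqxx ?setU11.
    apply: subset_trans SX _; apply/bigcupsP=> j _.
    apply: (subset_trans _ (bigcup_sup j _)) => //=.
    by case: ifP => _; rewrite ?subsetUr.
  apply: leq_sum => j _; case: eqP => // ->.
  by have := rank_subadditive [set x] (X i) (rP i); rewrite loop.
rewrite negb_exists_in => /forall_inP noloop.
have {}noloop x i : x \in S -> 0 < r i [set x].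
  by move=> /noloop; rewrite negb_exists lt0n => /forallP.
have [/existsP[i dep]|] := boolP [exists i, r i S < #|S|]; last first.
  rewrite negb_exists => /forallP ind.
  have -> : common_independent r S = powerset S.
    apply/setP=> A; rewrite powersetE inE; case: (boolP (A \subset S)) => //= AS.
    apply/forallP=> i; have := rank_nullity (rP i) AS; have := ind i.
    by have [/(_ A) ? _ _] := rP i; rewrite -leqNgt; lia.
  have [S0|] := eqVneq S set0; last exact: acyclic_powerset.
  have := cov (fun=> set0); rewrite S0 sub0set => /(_ isT).
  rewrite big1 => [|j _]; last by have [/(_ set0)] := rP j; rewrite cards0; lia.
  by rewrite leqn0 muln_eq0 => /orP[|/eqP->]; [lia | ].
(* From here on the i-th matroid is elongated; the complex at hand is recovered
   from the larger one by deleting the stars of the circuits of r i. *)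
pose r' j := if j == i then elongation (r j) else r j.
have r'P j : rank_function (r' j).
  by rewrite /r'; case: eqP => // _; apply: rank_function_elongation.
have r'E j A : r j A <= r' j A.
  rewrite /r'; case: eqP => // _.
  by have [/(_ A) ? _ _] := rP j; rewrite /elongation; lia.
pose s := enum [set sigma | circuit (r i) sigma].
have -> : common_independent r S = delete_stars (common_independent r' S) s.
  apply/setP=> A; rewrite !inE -andbA; case: (boolP (A \subset S)) => //= AS.
  apply/forallP/andP=> [indA|[/forallP indA /allP nc] j].
    split.
      apply/forallP=> j; have := r'E j A; have := indA j.
      by have [/(_ A) ? _ _] := r'P j; lia.
    apply/allP=> sigma; rewrite mem_enum inE => /minsetP[dep_s _].
    by apply/negP=> /(rank_nullity (rP i)); rewrite (eqP (indA i)); lia.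
  have [->|/negPf neq] := eqVneq j i; last by have := indA j; rewrite /r' neq.
  have [r_card _ _] := rP i.
  rewrite eqn_leq r_card leqNgt; apply/negP=> depA.
  have [sigma cs sA] := minset_exists (P := fun B => r i B < #|B|) depA.
  by have := nc sigma; rewrite mem_enum inE sA => /(_ cs).
apply: acyclic_delete_stars.
- exact: common_independent_complex.
- move=> sigma rho; rewrite !mem_enum !inE => cs cr A; rewrite inE => /andP[_ /forallP/(_ i)].
  rewrite /r' eqxx /elongation => /eqP indA sA rA.
  by apply: circuit_unique cs cr sA rA _ => //; rewrite -indA geq_minl.
- apply: IHm => // [|X /cov/leq_trans->//]; last exact: leq_sum.
  rewrite (bigD1 i) //= in le_m; rewrite (bigD1 i) //= {1}/r' eqxx.
  rewrite (eq_bigr (fun j => #|S| - r j S)) => [|j /negPf ji]; last by rewrite /r' ji.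
  by rewrite /elongation; lia.
move=> sigma; rewrite mem_enum inE => cs.
(* A circuit of r i that is dependent in another matroid has an empty star, and
   its link has no face to form a cycle. *)
have [sC|sC] := boolP (sigma \in common_independent r' S); last first.
  move=> d z _ zC _; exists (fun=> false) => // A.
  rewrite /boundary big1 //; apply/esym/negbTE/negP=> /zC[].
  rewrite inE => /andP[_ /(common_independent_complex r'P (subsetUr A sigma))].
  by rewrite (negPf sC).
rewrite link_common_independent //.
have := sC; rewrite inE => /andP[sS /forallP inds].
have card_s : 1 < #|sigma|.
  rewrite (card_circuit (rP i) cs) ltnS lt0n; apply/negP=> /eqP rs0.
  have [x xs] : exists x, x \in sigma.
    by apply/set0Pn; rewrite -card_gt0 (card_circuit (rP i) cs).
  have [_ /(_ [set x] sigma) + _] := rP i; rewrite sub1set xs rs0 => /(_ isT).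
  by have := noloop x i (subsetP sS x xs); lia.
apply: IHm => [|j|X covX].
- have := cardsID sigma S; rewrite (setIidPr sS) => cardS.
  suff : \sum_j (#|S :\: sigma| - contract (r' j) sigma (S :\: sigma)) <=
      \sum_j (#|S| - r j S) by lia.
  apply: leq_sum => j _; rewrite /contract setD_subK // (eqP (inds j)).
  have [_ /(_ _ _ sS) + _] := r'P j; rewrite (eqP (inds j)).
  by have := r'E j S; lia.
- exact: rank_function_contract.
have := cov (fun j => X j :|: sigma).
have -> : S \subset \bigcup_j (X j :|: sigma).
  apply/subsetP=> x xS; have [xs|xs] := boolP (x \in sigma).
    by apply/bigcupP; exists i; rewrite // inE xs orbT.
  have /(subsetP covX)/bigcupP[j _ xX] : x \in S :\: sigma by rewrite inE xs.
  by apply/bigcupP; exists j; rewrite // inE xX.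
move=> /(_ isT).
(* In the elongation the rank of a set containing the circuit sigma is one more
   than before; this is the unit gained in the i-th summand. *)
have : \sum_j (r j (X j :|: sigma) + (j == i)) <=
    \sum_j (contract (r' j) sigma (X j) + #|sigma|).
  apply: leq_sum => j _; rewrite /contract (eqP (inds j)).
  have [-> | /negPf ji] := eqVneq j i; last by rewrite /r' ji; lia.
  have := rank_nullity (rP i) (subsetUr (X i) sigma).
  by rewrite /r' eqxx /elongation (card_circuit (rP i) cs); lia.
rewrite !big_split /= sum_nat_const card_ord.
have -> : \sum_(j < k) (j == i : nat) = 1.
  by rewrite (bigD1 i) //= eqxx big1 // => j /negPf->.
set Q := \sum_j contract _ _ _; set R := \sum_j r _ _.
move: Q R card_s => Q R; move: #|sigma| => c; clear -k_gt0.
move=> c_gt1 RQ gR; have [?|?] := leqP g.+1 c; first by rewrite (eqP (_ : g.+1 - c == 0)) ?muln0.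
(* What remains is (k - 1) * (c - 2) >= 0 for c = |sigma| >= 2. *)
nia.
Qed.

End RankFunctions.

(** * The rank of a matroid given by its independent sets *)

Section MatroidRank.
Variable V : finType.
Implicit Types (M : {set {set V}}) (A B I J X : {set V}).

Definition rank M X := \max_(I in M | I \subset X) #|I|.

Lemma card_le_rank M I X : I \in M -> I \subset X -> #|I| <= rank M X.
Proof. by move=> IM IX; apply: (bigmax_sup I); rewrite ?IM. Qed.

Lemma rank_witness M X : is_complex M ->
  exists I, [/\ I \in M, I \subset X & #|I| = rank M X].
Proof.
case=> /set0Pn[B BM] Mdown.
have M0 : (set0 \in M) && (set0 \subset X) by rewrite (Mdown set0 B) ?sub0set.
rewrite /rank (bigmax_eq_arg set0) //.
by case: arg_maxnP => // I /andP[IM IX] _; exists I.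
Qed.

Lemma rank_extend M I X : is_matroid M -> I \in M -> I \subset X ->
  exists J, [/\ J \in M, I \subset J, J \subset X & #|J| = rank M X].
Proof.
move=> [Mc exch] IM IX; have [B [BM BX eB]] := rank_witness X Mc.
have [n] := ubnP (rank M X - #|I|); elim: n => // n IHn in I IM IX *; rewrite ltnS => le_n.
have [lt_I|ge_I] := ltnP #|I| #|B|; last first.
  by exists I; split=> //; apply/eqP; rewrite eqn_leq card_le_rank // -eB.
have [x /setDP[xB xI] xIM] := exch I B IM BM lt_I.
have [||J [JM IJ JX eJ]] := IHn (x |: I) xIM.
- by rewrite subUset sub1set (subsetP BX).
- by rewrite cardsU1 xI; lia.
by exists J; split=> //; apply: subset_trans (subsetUr _ _) IJ.
Qed.

(** Submodularity: extend a maximal independent subset I of the intersection of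
    X and Y to a maximal independent subset J of their union.  Then J meets X
    and Y in independent sets whose intersection contains I. *)
Lemma rank_function_rank M : is_matroid M -> rank_function (rank M).
Proof.
move=> mM; have [Mc _] := mM; have [_ Mdown] := Mc; split=> [X|X Y sXY|X Y].
- by apply/bigmax_leqP=> I /andP[_ /subset_leq_card].
- apply/bigmax_leqP=> I /andP[IM IX].
  by apply: card_le_rank; rewrite // (subset_trans IX).
have [I [IM IXY <-]] := rank_witness (X :&: Y) Mc.
have IU : I \subset X :|: Y.
  by apply: subset_trans IXY _; rewrite subIset // subsetUl.
have [J [JM IJ JXY <-]] := rank_extend mM IM IU.
have JX := card_le_rank (Mdown _ _ (subsetIl J X) JM) (subsetIr J X).
have JY := card_le_rank (Mdown _ _ (subsetIl J Y) JM) (subsetIr J Y).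
have eU : J :&: X :|: J :&: Y = J by rewrite -setIUr; apply/setIidPl.
have sI : I \subset (J :&: X) :&: (J :&: Y).
  by rewrite -setIIr subsetI IJ.
have := cardsUI (J :&: X) (J :&: Y); rewrite eU; have := subset_leq_card sI; lia.
Qed.

Lemma rank_full M X : is_complex M -> rank M X = #|X| -> X \in M.
Proof.
move=> Mc rX; have [I [IM IX eI]] := rank_witness X Mc.
suff <- : I = X by [].
by apply/eqP; rewrite eqEcard IX eI rX leqnn.
Qed.

Lemma card_le_cover M n X : is_complex M -> covered_by_faces M n ->
  #|X| <= n * rank M X.
Proof.
move=> [_ Mdown] [S [SM covS <-]].
pose P := [set A :&: X | A in S].
have cov : X \subset cover P.
  apply/subsetP=> x xX; have : x \in cover S by rewrite covS inE.
  case/bigcupP=> A AS xA; apply/bigcupP; exists (A :&: X); last by rewrite inE xA.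
  exact: imset_f.
apply: leq_trans (subset_leq_card cov) _; apply: leq_trans (leq_card_cover _) _.
apply: leq_trans (_ : #|P| * rank M X <= _); last first.
  by rewrite leq_mul2r leq_imset_card orbT.
rewrite -sum_nat_const; apply: leq_sum => _ /imsetP[A /(subsetP SM) AM ->].
by apply: card_le_rank (subsetIr _ _); apply: Mdown AM; apply: subsetIl.
Qed.

End MatroidRank.

(** * From list colorings to transversals *)

Section Slices.
Variables V K : finType.

Definition slice (X : {set V * K}) c := [set v | (v, c) \in X].

Lemma sum_card_slice (X : {set V * K}) : \sum_c #|slice X c| = #|X|.
Proof.
transitivity (\sum_c \sum_(v | (v, c) \in X) 1).
  by apply: eq_bigr => c _; rewrite sum1dep_card.
rewrite (exchange_big_dep predT) //= pair_big_dep -sum1_card.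
by apply: eq_bigl => -[].
Qed.

(** The rank function of the direct sum, over the colors, of copies of r. *)
Definition sliced_rank (r : {set V} -> nat) X := \sum_c r (slice X c).

Lemma rank_function_sliced_rank r : rank_function r -> rank_function (sliced_rank r).
Proof.
case=> r_card r_mono r_sub; rewrite /sliced_rank; split=> [A|A B sAB|A B].
- rewrite -sum_card_slice; exact: leq_sum.
- apply: leq_sum => c _; apply: r_mono; apply/subsetP=> v; rewrite !inE; exact: (subsetP sAB).
rewrite -!big_split /=; apply: leq_sum => c _.
have -> : slice (A :|: B) c = slice A c :|: slice B c by apply/setP=> v; rewrite !inE.
have -> : slice (A :&: B) c = slice A c :&: slice B c by apply/setP=> v; rewrite !inE.
exact: r_sub.
Qed.

End Slices.

(** By the density condition, sets X_i covering the pairs over J satisfy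
    D * (r_1(X_1) + ... + r_k(X_k)) >= |E_J| = |J| (2k-1) D, so the transversal
    theorem applies to the common independent sets of pairs. *)
Lemma list_colorable_common (V : finType) (k : nat) (M : 'I_k -> {set {set V}}) D :
    0 < k -> (forall i, is_matroid (M i)) ->
    (forall i (X : {set V}), #|X| <= D * rank (M i) X) ->
  list_colorable (\bigcap_(i < k) M i) ((2 * k - 1) * D).
Proof.
move=> k_gt0 mM leD K L cardL.
pose r i : {set V * K} -> nat := sliced_rank (rank (M i)).
have rP i : rank_function (r i) by apply/rank_function_sliced_rank/rank_function_rank.
pose E := [set vc : V * K | vc.2 \in L vc.1].
have [A [AC pA cardA]] : exists A, [/\ A \in common_independent r E,
    fst @: A = [set: V] & #|A| = #|V|].
  apply: exists_transversal_face => [||J].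
  - exact: common_independent_complex.
  - rewrite inE sub0set; apply/forallP=> i; rewrite cards0.
    by have [/(_ set0) + _ _] := rP i; rewrite cards0; lia.
  have -> : restrict fst (common_independent r E) J =
      common_independent r [set vc in E | vc.1 \in J].
    apply/setP=> A; rewrite !inE andbAC; congr (_ && _).
    apply/andP/subsetP=> [[/subsetP AE /subsetP AJ] vc vcA|AEJ].
      by rewrite inE AE // AJ // imset_f.
    split; apply/subsetP; first by move=> vc /AEJ; rewrite inE => /andP[].
    by move=> _ /imsetP[vc /AEJ + ->]; rewrite inE => /andP[].
  apply: acyclic_common_independent => // X cov.
  have [->|J0] := eqVneq J set0; first by rewrite cards0 muln0.
  have cardE : #|[set vc in E | vc.1 \in J]| = #|J| * ((2 * k - 1) * D).
    rewrite -sum_nat_const -sum1_card -(eq_bigr _ (fun v _ => cardL v)).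
    under [RHS]eq_bigr do rewrite -sum1_card.
    by rewrite pair_big_dep; apply: eq_bigl => vc; rewrite !inE andbC.
  have : #|[set vc in E | vc.1 \in J]| <= \sum_i #|X i|.
    apply: leq_trans (subset_leq_card cov) _.
    elim/big_rec2: _ => [|i n Y _ le_n]; first by rewrite cards0.
    by apply: leq_trans (leq_card_setU _ _) _; rewrite leq_add2l.
  have : \sum_i #|X i| <= D * \sum_i r i (X i).
    rewrite big_distrr; apply: leq_sum => i _ /=.
    rewrite -sum_card_slice /r /sliced_rank big_distrr.
    by apply: leq_sum => c _; apply: leD.
  have D_gt0 : 0 < D.
    case/set0Pn: J0 => v _; have [i] : exists i : 'I_k, true by exists (Ordinal k_gt0).
    by have := leD i [set v]; rewrite cards1; case: D {leD cardL cardE}.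
  rewrite cardE => h1 h2; rewrite -(leq_pmul2l D_gt0).
  apply: leq_trans (leq_trans h2 h1).
  by rewrite mulnCA [X in _ <= X]mulnCA (mulnC D).
move: AC; rewrite inE => /andP[/subsetP AE /forallP indA].
have pinj : {in A &, injective fst} by apply/imset_injP; rewrite pA cardsT cardA.
have fA v : exists c, (v, c) \in A.
  have /imsetP[[u c] uA ->] : v \in fst @: A by rewrite pA inE.
  by exists c.
have [f fP] := fin_all_exists fA.
exists f; split=> [v|c]; first by have /AE := fP v; rewrite inE.
have -> : f @^-1: [set c] = slice A c.
  apply/setP=> v; rewrite !inE; apply/eqP/idP=> [<-//|vcA].
  by have [] := pinj _ _ vcA (fP v) erefl.
apply/bigcapP=> i _; apply: rank_full; first by case: (mM i).
have [r_card _ _] := rank_function_rank (mM i).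
have /eqP := indA i; rewrite /r /sliced_rank -sum_card_slice.
rewrite (bigD1 c) //= [RHS](bigD1 c) //=.
have : \sum_(d | d != c) rank (M i) (slice A d) <= \sum_(d | d != c) #|slice A d|.
  by apply: leq_sum => d _.
by have := r_card (slice A c); lia.
Qed.

Theorem corollary7p2 (V : finType) (k : nat) (M : 'I_k -> {set {set V}})
    (hk : 1 <= k)
    (matroidM : forall i, is_matroid (M i))
    (looplessM : forall i, loopless (M i)) :
  list_chromatic_number (\bigcap_(i < k) M i)
    <= (2 * k - 1) * \max_(i < k) chromatic_number (M i).
Proof.
have cC : is_complex (\bigcap_(i < k) M i).
  split; last first.
    move=> A B AB /bigcapP BM; apply/bigcapP=> i _.
    by have [[_ Mdown] _] := matroidM i; apply: Mdown AB (BM i _).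
  apply/set0Pn; exists set0; apply/bigcapP=> i _.
  have [[/set0Pn[A AM] Mdown] _] := matroidM i.
  exact: Mdown (sub0set A) AM.
have lC : loopless (\bigcap_(i < k) M i).
  by move=> v; apply/bigcapP=> i _; apply: looplessM.
have [_] := list_chromatic_numberP cC lC; apply.
apply: list_colorable_common => // i X; have [cov _] := chromatic_numberP (looplessM i).
apply: leq_trans (card_le_cover _ (matroidM i).1 cov) _.
by rewrite leq_mul2r (leq_bigmax i) orbT.
Qed.
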